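(* For any finite simple undirected graph $G$, $\text{2-}\eta_{P}(G)\leq \theta(G)-\tau(G)+\mathrm{c}(G)$.
   Context: $P(G)$ is the parity Laplacian of $G$: the $\mathbb{F}_2$-matrix obtained by reducing the Laplacian $L(G)=D(G)-A(G)$ (equivalently $D(G)+A(G)$) modulo $2$, so its diagonal entries are the degrees mod 2 and off-diagonal entries are the adjacency entries. $\text{2-}\eta_{P}(G)$ is the dimension of the kernel of $P(G)$ over $\mathbb{F}_2$. $\mathrm{c}(G)$ is the number of connected components; $\theta(G)=\mathrm{e}(G)-\mathrm{v}(G)+\mathrm{c}(G)$ is the circuit rank (dimension over $\mathbb{F}_2$ of the cycle space of edge sets in which every vertex has even degree). A cycle is odd if it has an odd number of edges; two cycles are disjoint if they share no edge; $\tau(G)$ is the maximum cardinality of a set of pairwise disjoint odd cycles of $G$. *)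

(* Defs.v *)
From mathcomp Require Import all_boot all_order all_algebra.

Set Implicit Arguments.
Unset Strict Implicit.
Unset Printing Implicit Defensive.

Import GRing.Theory.
Local Open Scope ring_scope.

(* A finite simple graph is a symmetric irreflexive adjacency relation e on a *)
(* finite type T; an edge is the two-element set of its endpoints.            *)

Definition degree (T : finType) (e : rel T) (x : T) : nat := #|[set y | e x y]|.

Definition edges (T : finType) (e : rel T) : {set {set T}} :=
  [set [set p.1; p.2] | p : T * T & e p.1 p.2].

Definition ncomponents (T : finType) (e : rel T) : nat := n_comp e T.

(* Valued in int because the subtraction of nat is truncated. *)
Definition circuit_rank (T : finType) (e : rel T) : int :=
  #|edges e|%:Z - #|T|%:Z + (ncomponents e)%:Z.

Definition degree_mx (T : finType) (e : rel T) : 'M[int]_#|T| :=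
  \matrix_(i, j) ((degree e (enum_val i))%:Z *+ (i == j)).

Definition adjacency_mx (T : finType) (e : rel T) : 'M[int]_#|T| :=
  \matrix_(i, j) (e (enum_val i) (enum_val j) : nat)%:Z.

Definition laplacian (T : finType) (e : rel T) : 'M[int]_#|T| :=
  degree_mx e - adjacency_mx e.

Definition parity_laplacian (T : finType) (e : rel T) : 'M['F_2]_#|T| :=
  map_mx intr (laplacian e).

(* kermx is the kernel of u |-> u *m A on row vectors, so the transpose gives *)
(* the kernel of the action on column vectors.                                *)
Definition parity_nullity (T : finType) (e : rel T) : nat :=
  \rank (kermx (parity_laplacian e)^T).

Definition cycle_edges (T : finType) (c : seq T) : {set {set T}} :=
  [set [set x; next c x] | x in c].

(* Cycles are identified with their edge sets. A cycle with n edges visits n  *)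
(* distinct vertices, whence the length of the tuple; n > 2 excludes an edge  *)
(* traversed back and forth, which ucycleb accepts.                           *)
Definition is_cycle (T : finType) (e : rel T) (C : {set {set T}}) : bool :=
  (2 < #|C|)%N &&
  [exists c : #|C|.-tuple T, ucycleb e c && (C == cycle_edges c)].

Definition odd_cycles (T : finType) (e : rel T) : {set {set {set T}}} :=
  [set C | is_cycle e C & odd #|C|].

(* trivIset S says that the members of S are pairwise disjoint as edge sets.  *)
Definition odd_cycle_packing (T : finType) (e : rel T) : nat :=
  \max_(S : {set {set {set T}}} | (S \subset odd_cycles e) && trivIset S) #|S|.

(* Main.v *)
(* Let B be the vertex-edge incidence matrix over F_2 and c(G) the number of  *)
(* components. Then P(G) = B B^T, and rank B >= v(G) - c(G) because a vector  *)
(* killed by B is constant on each component. Let the rows of C be the edge   *)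
(* sets of t disjoint odd cycles: C C^T = 1 since the cycles are odd and      *)
(* disjoint, and B C^T = 0 since a cycle has even degree at every vertex.     *)
(* Stacking B over C gives a matrix D with e(G) columns, of rank              *)
(* rank B + t, whose Gram matrix D D^T has rank rank P(G) + t, so Sylvester's *)
(* inequality gives 2 (rank B + t) <= e(G) + rank P(G) + t.                   *)
Require Import Defs.
From mathcomp Require Import all_boot all_order all_algebra.
From mathcomp Require Import zify.

Set Implicit Arguments.
Unset Strict Implicit.
Unset Printing Implicit Defensive.

Import Order.TTheory GRing.Theory Num.Theory.
Local Open Scope ring_scope.

(** The linear algebra is [mxrank_gram_orthonormal], valid over any field:
    [2 rank B + t <= e(G) + rank (B B^T)]. The graph enters through [parity_laplacianE],
    [rank_incidence_ge] and [cycle_degree_even]. Substituting [rank B >= v - c] and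
    [rank P = v - eta] gives [eta <= e - v + 2c - t], which is [theta - t + c]. *)

Lemma mxrank_gram_orthonormal (F : fieldType) (n m t : nat)
    (B : 'M[F]_(n, m)) (C : 'M[F]_(t, m)) :
  B *m C^T = 0 -> C *m C^T = 1%:M ->
  ((\rank B).*2 + t <= m + \rank (B *m B^T))%N.
Proof.
move=> BC0 CC1.
have rC : \rank C = t.
  by apply/eqP; apply/row_freeP; exists C^T.
have CB0 : C *m B^T = 0 by rewrite -[LHS]trmxK trmx_mul trmxK BC0 trmx0.
(* A common vector [u B = v C] of the two row spaces gives [v = 0] after right multiplication by
   [C^T]. *)
have BIC0 : (B :&: C)%MS = 0.
  apply/eqP; rewrite -submx0; apply/rV_subP => w.
  rewrite sub_capmx => /andP[/submxP[u ->] /submxP[v uBvC]].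
  have v0 : v = 0.
    by rewrite -[v]mulmx1 -CC1 mulmxA -uBvC -mulmxA BC0 mulmx0.
  by rewrite uBvC v0 mul0mx sub0mx.
pose D := col_mx B C.
have rD : \rank D = (\rank B + t)%N.
  by rewrite /D -addsmxE (mxrank_disjoint_sum BIC0) rC.
have DDT : \rank (D *m D^T) = (\rank (B *m B^T) + t)%N.
  by rewrite /D tr_col_mx mul_col_row BC0 CB0 CC1 rank_diag_block_mx mxrank1.
by have := mxrank_mul_min D D^T; rewrite mxrank_tr DDT rD; lia.
Qed.

Lemma pchar_F2 : 2 \in [pchar 'F_2].
Proof. exact: pchar_Fp. Qed.

Lemma natr_F2 n : n%:R = (odd n)%:R :> 'F_2.
Proof.
rewrite -[in LHS](odd_double_half n) natrD -muln2 natrM.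
by rewrite (pcharf0 pchar_F2) mulr0 addr0.
Qed.

Lemma sumr_mem_natr (R : pzSemiRingType) (T : finType) (A : {pred T})
    (P : pred T) :
  \sum_(x in A) (P x)%:R = #|[set x in A | P x]|%:R :> R.
Proof.
rewrite -natr_sum -sum1_card; congr _%:R; rewrite big_mkcond [RHS]big_mkcond.
by apply: eq_bigr => x _; rewrite inE; case: (x \in A); case: (P x).
Qed.

Lemma sumr_enum_val_natr (R : pzSemiRingType) (T : finType) (A : {pred T})
    (P : pred T) :
  \sum_(j < #|A|) (P (enum_val j))%:R = #|[set x in A | P x]|%:R :> R.
Proof. by rewrite -sumr_mem_natr [RHS]big_enum_val. Qed.

Section Incidence.

Variables (T : finType) (e : rel T).
Hypotheses (e_sym : symmetric e) (e_irr : irreflexive e).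

Definition incidence_mx : 'M['F_2]_(#|T|, #|edges e|) :=
  \matrix_(i, j) ((enum_val i : T) \in (enum_val j : {set T}))%:R.

Definition family_mx (S : {set {set {set T}}}) : 'M['F_2]_(#|S|, #|edges e|) :=
  \matrix_(i, j) ((enum_val j : {set T}) \in (enum_val i : {set {set T}}))%:R.

Lemma mem_edges x y : e x y -> [set x; y] \in edges e.
Proof. by move=> exy; apply/imsetP; exists (x, y); rewrite ?inE. Qed.

Lemma edges_at x f :
  f \in edges e -> x \in f -> exists2 y, e x y & f = [set x; y].
Proof.
case/imsetP=> -[a b]; rewrite inE /= => eab ->; rewrite !inE => /orP[]/eqP->.
  by exists b.
by exists a; [rewrite e_sym | rewrite setUC].
Qed.

Lemma card_edges_at x : #|[set f in edges e | x \in f]| = degree e x.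
Proof.
have -> : [set f in edges e | x \in f] =
          [set [set x; y] | y in [set y | e x y]].
  apply/setP=> f; rewrite inE; apply/andP/imsetP.
    by case=> /edges_at fE /fE[y exy ->]; exists y; rewrite ?inE.
  by case=> y; rewrite inE => exy ->; rewrite mem_edges // set21.
apply: card_in_imset => y z; rewrite !inE => exy exz.
move/setP/(_ y); rewrite set22 !inE => /esym/orP[]/eqP // yx.
by rewrite yx e_irr in exy.
Qed.

(** In a simple graph an edge is determined by its two endpoints. *)
Lemma card_edges_at2 x z :
  x != z -> #|[set f in edges e | (x \in f) && (z \in f)]| = e x z.
Proof.
move=> xz; have [exz | nexz] := boolP (e x z).
  apply/eqP/cards1P; exists [set x; z]; apply/setP=> f; rewrite !inE.
  apply/and3P/eqP => [[/edges_at fE /fE[y _ ->]]|->]; last first.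
    by rewrite mem_edges ?set21 ?set22.
  by rewrite !inE eq_sym (negPf xz) /= => /eqP->.
apply/eqP; rewrite cards_eq0; apply/eqP/setP => f; rewrite !inE.
apply/and3P => -[/edges_at fE /fE[y exy ->]].
by rewrite !inE eq_sym (negPf xz) /= => /eqP zy; rewrite zy exy in nexz.
Qed.

Lemma parity_laplacianE : parity_laplacian e = incidence_mx *m incidence_mx^T.
Proof.
apply/matrixP=> i k; rewrite !mxE.
under eq_bigr => j _ do rewrite !mxE -natrM mulnb.
rewrite (sumr_enum_val_natr _ (edges e)
  (fun f => (enum_val i \in f) && (enum_val k \in f))).
rewrite rmorphB rmorphMn /= !pmulrn.
have [<-{k} | ik] := eqVneq i k.
  under eq_finset => f do rewrite andbb.
  by rewrite card_edges_at e_irr subr0.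
rewrite card_edges_at2 ?(inj_eq enum_val_inj) //.
by rewrite sub0r (oppr_pchar2 pchar_F2).
Qed.

Lemma connect_const (rT : Type) (u : T -> rT) :
  (forall x y, e x y -> u x = u y) -> forall x y, connect e x y -> u x = u y.
Proof.
move=> u_e x _ /connectP[p + ->].
by elim: p x => //= y p IHp x /andP[/u_e-> /IHp].
Qed.

(** The column of the edge [[set x; y]] has ones exactly at [x] and [y], so [u] satisfies
    [u_x + u_y = 0], which is equality in characteristic 2. *)
Lemma ker_incidence_const (u : 'rV_#|T|) x y :
  u *m incidence_mx = 0 -> e x y ->
  u 0 (enum_rank x) = u 0 (enum_rank y).
Proof.
move=> uB0 exy; have exyE := mem_edges exy.
move/rowP/(_ (enum_rank_in exyE [set x; y])): uB0; rewrite !mxE.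
rewrite (reindex _ (onW_bij _ (enum_rank_bij T))) /=.
have xy : y != x by apply: contraTneq exy => ->; rewrite e_irr.
rewrite (bigD1 x) //= (bigD1 y) //= big1 => [|z /andP[zx zy]].
  rewrite !mxE !enum_rankK enum_rankK_in // set21 set22 !mulr1 addr0 => /eqP.
  by rewrite addr_eq0 (oppr_pchar2 pchar_F2) => /eqP.
by rewrite !mxE enum_rankK enum_rankK_in // !inE (negPf zx) (negPf zy) mulr0.
Qed.

Lemma rank_incidence_ge : (#|T| <= \rank incidence_mx + ncomponents e)%N.
Proof.
rewrite -leq_subLR -mxrank_ker /ncomponents /n_comp_mem.
set A := predI _ _.
(* The rows of [R] are the indicator vectors of the components, one for each root; they span a space
   containing the kernel, whose dimension is thus at most the number of components. *)
pose R : 'M['F_2]_(#|A|, #|T|) :=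
  \matrix_(i, j) (enum_val i == fingraph.root e (enum_val j))%:R.
apply: leq_trans (rank_leq_row R); apply/mxrankS/row_subP => i.
set u := row i _.
have uB0 : u *m incidence_mx = 0 by rewrite -row_mul mulmx_ker row0.
(* The coefficients are the values of [u] at the roots; at each vertex only the row of its own
   component contributes. *)
apply/submxP; exists (\row_j u 0 (enum_rank (enum_val j))).
apply/rowP => k; rewrite [RHS]mxE.
under eq_bigr => j _ do rewrite [X in X * _]mxE [X in _ * X]mxE.
have csym := sym_connect_sym e_sym.
have rA : fingraph.root e (enum_val k) \in A by rewrite inE roots_root.
rewrite (bigD1 (enum_rank_in rA (fingraph.root e (enum_val k)))) //= big1 => [|j].
  rewrite !enum_rankK_in // eqxx mulr1 addr0 -[in LHS](enum_valK k).
  pose w x := u 0 (enum_rank x); apply: (@connect_const _ w).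
    by move=> x y; apply: ker_incidence_const.
  exact: connect_root.
move=> jr; case: eqP => [jE | _]; last by rewrite mulr0.
by case/eqP: jr; apply: enum_val_inj; rewrite enum_rankK_in.
Qed.

Lemma cycle_sub_edges C : is_cycle e C -> C \subset edges e.
Proof.
case/andP=> _ /existsP[c /andP[/andP[e_c _] /eqP->]].
apply/subsetP => _ /imsetP[x xc ->].
exact/mem_edges/(next_cycle e_c).
Qed.

Lemma cycle_degree_even C x : is_cycle e C -> ~~ odd #|[set f in C | x \in f]|.
Proof.
case/andP=> _ /existsP[c /andP[/andP[e_c c_uniq] /eqP CE]].
(* The tuple has length [#|C|], so no two of its steps give the same edge and edges can be counted
   by their starting vertices. *)
have f_inj : {in c &, injective (fun y => [set y; next c y])}.
  apply/imset_injP; rewrite -/(cycle_edges c) -CE.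
  by rewrite (card_uniqP c_uniq) size_tuple.
suff: #|[set f in C | x \in f]|%:R == 0 :> 'F_2 by rewrite natr_F2; case: odd.
rewrite -sumr_mem_natr CE big_imset //=.
(* The two terms are never both 1, since [next c y] differs from [y] by irreflexivity. *)
have step y : y \in c ->
    (x \in [set y; next c y])%:R = (y == x)%:R + (next c y == x)%:R :> 'F_2.
  move=> yc; rewrite !inE ![x == _]eq_sym; case: (eqVneq y x) => [<-|_].
    have := next_cycle e_c yc; case: eqP => [->|]; first by rewrite e_irr.
    by rewrite addr0.
  by rewrite add0r.
rewrite (eq_bigr _ step) big_split /=.
(* [next c] is a bijection, so [x] starts as many edges as it ends: the two sums agree and cancel in
   ['F_2]. *)
rewrite [X in X + _](reindex_onto (next c) (prev c)) /= => [|y _]; last first.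
  exact: next_prev.
under eq_bigl => y do rewrite mem_next prev_next // eqxx andbT.
by rewrite (addrr_pchar2 pchar_F2).
Qed.

End Incidence.

Theorem theorem5 (T : finType) (e : rel T)
    (e_sym : symmetric e) (e_irr : irreflexive e) :
  (parity_nullity e)%:Z <=
    circuit_rank e - (odd_cycle_packing e)%:Z + (ncomponents e)%:Z.
Proof.
have [S /andP[S_odd S_triv] packE] :
    {S : {set {set {set T}}} | (S \subset odd_cycles e) && trivIset S
       & odd_cycle_packing e = #|S|}.
  (* The maximum is attained because the empty packing is admissible. *)
  apply: eq_bigmax_cond; apply/card_gt0P; exists set0.
  by rewrite unfold_in sub0set; apply/trivIsetP => A B; rewrite inE.
have S_cycle (i : 'I_#|S|) : is_cycle e (enum_val i) /\ odd #|enum_val i : {set {set T}}|.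
  by have /(subsetP S_odd) := @enum_valP _ S i; rewrite inE => /andP.
pose B := incidence_mx e; pose C := family_mx e S.
(* Each entry is the degree modulo 2 of a vertex in one cycle of the packing. *)
have BC0 : B *m C^T = 0.
  apply/matrixP => i k; rewrite !mxE.
  have [Ck _] := S_cycle k.
  under eq_bigr => j _ do rewrite !mxE -natrM mulnb.
  rewrite (sumr_enum_val_natr _ (edges e)
    (fun f => (enum_val i \in f) && (f \in enum_val k))).
  have -> : [set f in edges e | (enum_val i \in f) && (f \in enum_val k)]
          = [set f in enum_val k | enum_val i \in f].
    apply/setP => f; rewrite !inE; case fk: (f \in enum_val k); rewrite ?andbF //.
    by rewrite andbT (subsetP (cycle_sub_edges Ck) _ fk).
  by rewrite natr_F2 (negPf (cycle_degree_even e_irr _ Ck)).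
(* Each entry is the parity of the intersection of two cycles: odd length on the diagonal,
   disjointness off it. *)
have CC1 : C *m C^T = 1%:M.
  apply/matrixP => i k; rewrite !mxE.
  have [Ci odd_i] := S_cycle i.
  under eq_bigr => j _ do rewrite !mxE -natrM mulnb.
  rewrite (sumr_enum_val_natr _ (edges e)
    (fun f => (f \in enum_val i) && (f \in enum_val k))).
  have -> : [set f in edges e | (f \in enum_val i) && (f \in enum_val k)]
          = enum_val i :&: enum_val k.
    apply/setP => f; rewrite !inE; case fi: (f \in enum_val i); rewrite ?andbF //.
    by rewrite (subsetP (cycle_sub_edges Ci) _ fi).
  have [<-|ik] := eqVneq i k; first by rewrite setIid natr_F2 odd_i.
  have /trivIsetP/(_ _ _ (enum_valP i) (enum_valP k)) := S_triv.
  by rewrite (inj_eq enum_val_inj) -setI_eq0 => /(_ ik)/eqP->; rewrite cards0.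
have := mxrank_gram_orthonormal BC0 CC1; rewrite -parity_laplacianE //.
have := rank_incidence_ge e_sym e_irr.
rewrite /parity_nullity mxrank_ker mxrank_tr /circuit_rank packE.
(* The bound [rank P <= v] makes the truncated subtraction in the nullity exact. *)
by have := rank_leq_row (parity_laplacian e); rewrite -/B; lia.
Qed.
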